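(* Let $R$ be any one of the following eight subsets of $\{0,1,2,3\}^2$: (A25) $\{(0,0),(0,1),(0,2),(1,1),(1,2),(3,0),(3,1),(3,2)\}$; (A26) $\{(1,0),(2,0),(3,0),(1,1),(2,1),(1,3),(2,3),(3,3)\}$; (A27) $\{(0,1),(0,2),(0,3),(2,1),(2,2),(3,1),(3,2),(3,3)\}$; (A28) $\{(0,1),(0,2),(0,3),(1,1),(1,2),(3,1),(3,2),(3,3)\}$; (A29) $\{(0,0),(1,0),(2,0),(1,2),(2,2),(0,3),(1,3),(2,3)\}$; (A30) $\{(0,0),(1,0),(2,0),(1,1),(2,1),(0,3),(1,3),(2,3)\}$; (A31) $\{(1,0),(2,0),(3,0),(1,2),(2,2),(1,3),(2,3),(3,3)\}$; (A32) $\{(0,0),(0,1),(0,2),(2,1),(2,2),(3,0),(3,1),(3,2)\}$. Then the mesh patterns $(123,R)$ and $(321,R)$ are jointly equidistributed.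
   Context: $S_n$ is the set of permutations of $\{1,\dots,n\}$. A mesh pattern of length $k$ is a pair $(\tau,R)$ with $\tau\in S_k$ and $R\subseteq\{0,\dots,k\}^2$; the element $(a,b)\in R$ is the ''shaded box'' whose corners are $(a,b),(a,b+1),(a+1,b+1),(a+1,b)$ in the plot of $\tau$ (first coordinate = position, second = value). An occurrence of $(\tau,R)$ in $\pi=\pi_1\cdots\pi_n\in S_n$ is a tuple of indices $i_1<\dots<i_k$ such that $\pi_{i_1}\cdots\pi_{i_k}$ is order-isomorphic to $\tau$ and, setting $i_0=0$, $i_{k+1}=n+1$, letting $v_1<\dots<v_k$ be the values $\pi_{i_1},\dots,\pi_{i_k}$ in increasing order and $v_0=0$, $v_{k+1}=n+1$, for every $(a,b)\in R$ there is no index $m$ with $i_a<m<i_{a+1}$ and $v_b<\pi_m<v_{b+1}$. The number of occurrences is the number of such index tuples. Two mesh patterns $q_1,q_2$ are jointly equidistributed if for all $n\ge 1$ and all integers $k,\ell\ge 0$, the number of $\pi\in S_n$ with exactly $k$ occurrences of $q_1$ and exactly $\ell$ occurrences of $q_2$ equals the number with exactly $\ell$ occurrences of $q_1$ and exactly $k$ occurrences of $q_2$. *)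

(* Defs.v *)
From mathcomp Require Import all_boot all_fingroup.

Set Implicit Arguments.
Unset Strict Implicit.
Unset Printing Implicit Defensive.

(* Permutations are elements of 'S_n, acting on the 0-based 'I_n; positions and
   values are shifted by one below, so that 0 and n.+1 are the two borders. *)

Record mesh_pattern (k : nat) := MeshPattern {
  underlying : 'S_k;
  shading : {set 'I_k.+1 * 'I_k.+1}
}.

(* i_a for 0 <= a <= k+1: the default value of nth supplies i_{k+1} = n+1. *)
Definition grid_pos (k n : nat) (t : k.-tuple 'I_n) (a : nat) : nat :=
  nth n.+1 (0 :: [seq (val i).+1 | i <- t]) a.

(* v_b for 0 <= b <= k+1, with the same convention. *)
Definition grid_val (k n : nat) (p : 'S_n) (t : k.-tuple 'I_n) (b : nat) : nat :=
  nth n.+1 (0 :: sort leq [seq (val (p i)).+1 | i <- t]) b.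

Definition in_box (k n : nat) (p : 'S_n) (t : k.-tuple 'I_n)
    (a b : nat) (m : 'I_n) : bool :=
  (grid_pos t a < m.+1 < grid_pos t a.+1) &&
  (grid_val p t b < (p m).+1 < grid_val p t b.+1).

Definition order_isomorphic (k n : nat) (tau : 'S_k) (p : 'S_n)
    (t : k.-tuple 'I_n) : bool :=
  [forall x : 'I_k, forall y : 'I_k,
     (p (tnth t x) < p (tnth t y)) == (tau x < tau y)].

Definition occurrence (k n : nat) (q : mesh_pattern k) (p : 'S_n)
    (t : k.-tuple 'I_n) : bool :=
  [&& sorted ltn [seq val i | i <- t],
      order_isomorphic (underlying q) p t &
      [forall ab in shading q, forall m : 'I_n, ~~ in_box p t ab.1 ab.2 m]].

Definition occurrences (k n : nat) (q : mesh_pattern k) (p : 'S_n) : nat :=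
  #|[set t : k.-tuple 'I_n | occurrence q p t]|.

Definition jointly_equidistributed (k1 k2 : nat)
    (q1 : mesh_pattern k1) (q2 : mesh_pattern k2) : Prop :=
  forall n : nat, 1 <= n -> forall k l : nat,
    #|[set p : 'S_n | (occurrences q1 p == k) && (occurrences q2 p == l)]| =
    #|[set p : 'S_n | (occurrences q1 p == l) && (occurrences q2 p == k)]|.

Definition perm123 : 'S_3 := 1%g.
Definition perm321 : 'S_3 := perm (@rev_ord_inj 3).

Definition boxes (s : seq (nat * nat)) : {set 'I_4 * 'I_4} :=
  [set ab : 'I_4 * 'I_4 | (val ab.1, val ab.2) \in s].

Definition A25 := boxes
  [:: (0,0); (0,1); (0,2); (1,1); (1,2); (3,0); (3,1); (3,2)].
Definition A26 := boxes
  [:: (1,0); (2,0); (3,0); (1,1); (2,1); (1,3); (2,3); (3,3)].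
Definition A27 := boxes
  [:: (0,1); (0,2); (0,3); (2,1); (2,2); (3,1); (3,2); (3,3)].
Definition A28 := boxes
  [:: (0,1); (0,2); (0,3); (1,1); (1,2); (3,1); (3,2); (3,3)].
Definition A29 := boxes
  [:: (0,0); (1,0); (2,0); (1,2); (2,2); (0,3); (1,3); (2,3)].
Definition A30 := boxes
  [:: (0,0); (1,0); (2,0); (1,1); (2,1); (0,3); (1,3); (2,3)].
Definition A31 := boxes
  [:: (1,0); (2,0); (3,0); (1,2); (2,2); (1,3); (2,3); (3,3)].
Definition A32 := boxes
  [:: (0,0); (0,1); (0,2); (2,1); (2,2); (3,0); (3,1); (3,2)].

(* Main.v *)
(** In an occurrence of [(123, R)] or [(321, R)] let [B] be the open rectangle
    spanned by the two outer points. For each of the eight shadings, the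
    shaded boxes outside [B] give a condition on the outer points alone, and
    those inside [B] say that the middle point is the leftmost, rightmost,
    lowest or highest point of [B]. So occurrences correspond to the pairs of
    outer points satisfying the outer condition and with [B] nonempty; which
    extreme point is asked for no longer matters. The outer condition is
    invariant under reversal (A25, A27, A28, A32) or under complement (A26,
    A29, A30, A31), and either symmetry exchanges increasing and decreasing
    pairs, hence the two statistics. *)
Require Import Defs.
From mathcomp Require Import all_boot all_fingroup.
From mathcomp Require Import zify.

Set Implicit Arguments.
Unset Strict Implicit.
Unset Printing Implicit Defensive.

Definition inside (i k lo hi x y : nat) : bool := (i < x < k) && (lo < y < hi).

(** The far border [n.+1] is left out of [xs] and [ys], being the default value of [nth]. Plain
    numbers keep the later case check within linear arithmetic. *)
Definition avoids_boxes (n : nat) (s : seq (nat * nat)) (xs ys : seq nat)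
    (x y : nat) : bool :=
  all (fun ab => ~~ ((nth n.+1 xs ab.1 < x < nth n.+1 xs ab.1.+1) &&
                     (nth n.+1 ys ab.2 < y < nth n.+1 ys ab.2.+1))) s.

(* [d] is [true] for the pattern 123 and [false] for 321; the outer points are
   [(i, lo)], [(k, hi)] in the first case and [(i, hi)], [(k, lo)] in the
   second. *)
Definition mesh_splits (s : seq (nat * nat))
    (outer : nat -> nat -> nat -> nat -> nat -> nat -> bool)
    (key : nat -> nat -> nat -> nat) : Prop :=
  forall (d : bool) (n i j k lo mid hi x y : nat),
  i < j < k -> k < n -> lo < mid < hi -> hi < n -> x < n -> y < n ->
  (x == i) = (y == if d then lo else hi) -> (x == j) = (y == mid) ->
  (x == k) = (y == if d then hi else lo) ->
  avoids_boxes n s [:: 0; i.+1; j.+1; k.+1] [:: 0; lo.+1; mid.+1; hi.+1]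
    x.+1 y.+1 =
  outer i k lo hi x y &&
  (inside i k lo hi x y ==> (key n j mid <= key n x y)).

(** One common coordinate is enough: it already identifies two points in the plot of a permutation,
    so a point of minimal key is unique. *)
Definition key_separates (key : nat -> nat -> nat -> nat) : Prop :=
  forall n x y x' y', x < n -> y < n -> x' < n -> y' < n ->
  key n x y = key n x' y' -> x = x' \/ y = y'.

Definition perm3 (d : bool) : 'S_3 := if d then perm123 else perm321.

(** * Occurrences as pairs of outer points *)

Section Occurrences.

Variables (n : nat) (p : 'S_n) (d : bool).

Let lo (i k : 'I_n) : nat := p (if d then i else k).
Let hi (i k : 'I_n) : nat := p (if d then k else i).

Lemma order_isomorphic3 (i j k : 'I_n) :
  order_isomorphic (perm3 d) p [tuple i; j; k] = (lo i k < p j < hi i k).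
Proof.
have tau (x : 'I_3) : perm3 d x = (if d then x else rev_ord x).
  by rewrite /perm3; case: (d); rewrite ?permE.
apply/forallP/andP => [iso | [hlo hhi] x]; last first.
  apply/forallP => y; rewrite !tau !(tnth_nth i); move: hlo hhi; rewrite /lo /hi.
  by case: d; case: x => [[|[|[|x]]] //= hx]; case: y => [[|[|[|y]]] //= hy];
    lia.
pose o (a : nat) (ha : a < 3) := Ordinal ha.
have := forallP (iso (o 0 isT)) (o 1 isT).
have := forallP (iso (o 1 isT)) (o 2 isT).
have := forallP (iso (o 1 isT)) (o 0 isT).
have := forallP (iso (o 2 isT)) (o 1 isT).
by rewrite !tau !(tnth_nth i) /lo /hi; case: d => /=; lia.
Qed.

Lemma occurrence3 (s : seq (nat * nat)) (i j k : 'I_n) :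
  all (fun ab => (ab.1 < 4) && (ab.2 < 4)) s ->
  occurrence (MeshPattern (perm3 d) (boxes s)) p [tuple i; j; k] =
  [&& i < j < k, lo i k < p j < hi i k &
      [forall m : 'I_n, avoids_boxes n s [:: 0; i.+1; j.+1; k.+1]
         [:: 0; (lo i k).+1; (p j).+1; (hi i k).+1] m.+1 (p m).+1]].
Proof.
move=> hs; rewrite /occurrence order_isomorphic3 /= andbT.
congr (_ && _); case: (boolP (lo i k < p j < hi i k)) => //= hval.
have vals : sort leq [:: (p i).+1; (p j).+1; (p k).+1] =
            [:: (lo i k).+1; (p j).+1; (hi i k).+1].
  apply: (sorted_eq leq_trans anti_leq (sort_sorted leq_total _)).
    by rewrite /=; lia.
  (* For 321 the values are listed in decreasing order, hence the reversal. *)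
  rewrite perm_sort /lo /hi; case: d => //.
  by rewrite -[X in perm_eq X _]revK perm_rev.
have box m (ab : nat * nat) : in_box p [tuple i; j; k] ab.1 ab.2 m =
    (nth n.+1 [:: 0; i.+1; j.+1; k.+1] ab.1 < m.+1 <
       nth n.+1 [:: 0; i.+1; j.+1; k.+1] ab.1.+1) &&
    (nth n.+1 [:: 0; (lo i k).+1; (p j).+1; (hi i k).+1] ab.2 < (p m).+1 <
       nth n.+1 [:: 0; (lo i k).+1; (p j).+1; (hi i k).+1] ab.2.+1).
  by rewrite /in_box /grid_pos /grid_val [map _ _]/= vals.
apply/forallP/forallP => [avoid m | avoid ab].
  apply/allP => -[a b] ab_s; have /andP[/= ha hb] := allP hs _ ab_s.
  have := avoid (Ordinal ha, Ordinal hb); rewrite inE /= ab_s => /forallP/(_ m).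
  by rewrite (box m (a, b)).
apply/implyP; rewrite inE => ab_s; apply/forallP => m.
by rewrite (box m (val ab.1, val ab.2)); have /allP/(_ _ ab_s) := avoid m.
Qed.

Variables (s : seq (nat * nat)).
Variables (outer : nat -> nat -> nat -> nat -> nat -> nat -> bool).
Variables (key : nat -> nat -> nat -> nat).
Hypotheses (s_lt4 : all (fun ab => (ab.1 < 4) && (ab.2 < 4)) s).
Hypotheses (s_splits : mesh_splits s outer key) (keyP : key_separates key).

Definition outer_pairs : {set 'I_n * 'I_n} :=
  [set ik : 'I_n * 'I_n | [&& ik.1 < ik.2, lo ik.1 ik.2 < hi ik.1 ik.2,
    [forall m : 'I_n, outer ik.1 ik.2 (lo ik.1 ik.2) (hi ik.1 ik.2) m (p m)] &
    [exists m : 'I_n, inside ik.1 ik.2 (lo ik.1 ik.2) (hi ik.1 ik.2) m (p m)]]].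

Lemma occurrence_extremal (i j k : 'I_n) :
  occurrence (MeshPattern (perm3 d) (boxes s)) p [tuple i; j; k] =
  [&& i < k, lo i k < hi i k,
      [forall m : 'I_n, outer i k (lo i k) (hi i k) m (p m)],
      inside i k (lo i k) (hi i k) j (p j) &
      [forall m : 'I_n, inside i k (lo i k) (hi i k) m (p m) ==>
         (key n j (p j) <= key n m (p m))]].
Proof.
rewrite occurrence3 //.
have [hpos|] := boolP (i < j < k); last first.
  by rewrite /inside => /negbTE->; rewrite !andbF.
have [hval|] := boolP (lo i k < p j < hi i k); last first.
  by rewrite /inside => /negbTE->; rewrite !andbF.
have -> : i < k by lia.
have -> : lo i k < hi i k by lia.
rewrite {1}/inside hpos hval /=.
(* Injectivity of [p] yields the three coincidence hypotheses of [mesh_splits]: a point on a grid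
   line through a pattern point is that point. *)
have pE (m m' : 'I_n) : (m == m' :> nat) = (p m == p m' :> nat).
  by rewrite !(inj_eq val_inj) (inj_eq perm_inj).
have iE (m : 'I_n) :
    (m == i :> nat) = ((p m : nat) == if d then lo i k else hi i k).
  by rewrite pE /lo /hi; case: d.
have kE (m : 'I_n) :
    (m == k :> nat) = ((p m : nat) == if d then hi i k else lo i k).
  by rewrite pE /lo /hi; case: d.
have split (m : 'I_n) := s_splits hpos (ltn_ord k) hval (ltn_ord _)
  (ltn_ord m) (ltn_ord (p m)) (iE m) (pE m j) (kE m).
apply/forallP/andP => [avoid | [/forallP hout /forallP hkey] m].
  by split; apply/forallP => m; have := avoid m; rewrite split => /andP[].
by rewrite split hout hkey.
Qed.

(** Forgetting the middle point is injective on occurrences, since that point is the unique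
    minimiser of [key] in the rectangle; a nonempty rectangle has one, which gives the image. *)
Lemma occurrences_outer_pairs :
  occurrences (MeshPattern (perm3 d) (boxes s)) p = #|outer_pairs|.
Proof.
pose ends (t : 3.-tuple 'I_n) := (tnth t ord0, tnth t ord_max).
have tupleE (t : 3.-tuple 'I_n) : exists i j k, t = [tuple i; j; k].
  case/tupleP: t => i t; case/tupleP: t => j t; case/tupleP: t => k t.
  by exists i, j, k; rewrite (tuple0 t); apply: val_inj.
rewrite /occurrences -(@card_in_imset _ _ ends) => [|t t'].
  congr #|pred_of_set _|; apply/setP => -[i k]; rewrite inE /=.
  apply/imsetP/and4P => [[t] | [hpos hval hout /existsP[j0 hj0]]].
    have [i' [j [k' ->]]] := tupleE t; rewrite inE occurrence_extremal.
    rewrite /ends !(tnth_nth i') /= => /and5P[? ? ? hj _] [-> ->].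
    by split=> //; apply/existsP; exists j.
  have [j hj jmin] := @arg_minnP _ j0
    (fun m => inside i k (lo i k) (hi i k) m (p m)) (fun m => key n m (p m)) hj0.
  exists [tuple i; j; k]; last by rewrite /ends !(tnth_nth i).
  rewrite inE occurrence_extremal; apply/and5P; split=> //.
  by apply/forallP => m; apply/implyP => /jmin.
have [i [j [k ->]]] := tupleE t; have [i' [j' [k' ->]]] := tupleE t'.
rewrite !inE !occurrence_extremal /ends !(tnth_nth i) /=.
move=> /and5P[_ _ _ hj /forallP jmin] /and5P[_ _ _ hj' /forallP jmin'] [ei ek].
rewrite -{}ei -{}ek in hj' jmin' *.
have /keyP : key n j (p j) = key n j' (p j').
  by apply/eqP; rewrite eqn_leq (implyP (jmin _) hj') (implyP (jmin' _) hj).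
case=> // /val_inj; first by move->.
by move/perm_inj->.
Qed.

End Occurrences.

(** * Reversal and complement *)

Definition reversal (n : nat) : 'S_n := perm (@rev_ord_inj n).

(** Products act left factor first, so [reversal n * p] reverses positions. The two ends trade
    places and keep their values, hence the reindexing [f] and the negated [d]. *)
Lemma outer_pairs_reversal n (p : 'S_n) d outer :
  (forall i k lo hi x y, i < n -> k < n -> x < n ->
     outer (n - k.+1) (n - i.+1) lo hi (n - x.+1) y = outer i k lo hi x y) ->
  #|outer_pairs (reversal n * p)%g d outer| = #|outer_pairs p (~~ d) outer|.
Proof.
move=> outerC; pose f (ik : 'I_n * 'I_n) := (rev_ord ik.2, rev_ord ik.1).
have f_inj : injective f by apply: inv_inj => -[i k]; rewrite /f /= !rev_ordK.
rewrite -(card_preimset _ f_inj); congr #|pred_of_set _|.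
apply/setP => -[i k]; rewrite !inE /=.
have rE (b : bool) (u v : 'I_n) :
    (reversal n * p)%g (if b then u else v) =
    p (if ~~ b then rev_ord v else rev_ord u).
  by rewrite permM permE; case: b.
have rE1 (u : 'I_n) : (reversal n * p)%g u = p (rev_ord u).
  by rewrite permM permE.
rewrite !rE !rev_ordK; have hi := ltn_ord i; have hk := ltn_ord k.
congr [&& _, _, _ & _]; first by lia.
- apply/forallP/forallP => h m; have := h (rev_ord m).
    by rewrite rE1 rev_ordK /= outerC.
  rewrite rE1 -(outerC i k) //.
  (* The subtraction is folded back into [rev_ord] so that the involution cancels. *)
  by rewrite -[n - (rev_ord m).+1]/(val (rev_ord (rev_ord m))) rev_ordK.
- apply/existsP/existsP => -[m hm]; exists (rev_ord m); move: hm;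
    have := ltn_ord m; rewrite rE1 ?rev_ordK /inside /=; lia.
Qed.

(** Multiplying on the right acts on values and leaves positions fixed, so the two sets of pairs are
    equal without reindexing. *)
Lemma outer_pairs_complement n (p : 'S_n) d outer :
  (forall i k lo hi x y, lo < n -> hi < n -> y < n ->
     outer i k (n - hi.+1) (n - lo.+1) x (n - y.+1) = outer i k lo hi x y) ->
  #|outer_pairs (p * reversal n)%g d outer| = #|outer_pairs p (~~ d) outer|.
Proof.
move=> outerC; congr #|pred_of_set _|; apply/setP => -[i k]; rewrite !inE /=.
have rE (u : 'I_n) : (p * reversal n)%g u = n - (p u).+1 :> nat.
  by rewrite permM permE.
rewrite !if_neg; set u := if d then i else k; set v := if d then k else i.
rewrite !rE; congr [&& _, _, _ & _].
- by have := ltn_ord (p u); have := ltn_ord (p v); lia.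
- by apply: eq_forallb => m; rewrite rE outerC.
- apply: eq_existsb => m; rewrite rE /inside.
  by have := ltn_ord (p u); have := ltn_ord (p v); have := ltn_ord (p m); lia.
Qed.

(** An injection of ['S_n] into itself preserves cardinalities under preimage, so exchanging the two
    statistics suffices. *)
Lemma jointly_equidistributed_swap k1 k2
    (q1 : mesh_pattern k1) (q2 : mesh_pattern k2) :
  (forall n, exists2 f : 'S_n -> 'S_n, injective f &
     forall p, occurrences q1 (f p) = occurrences q2 p /\
               occurrences q2 (f p) = occurrences q1 p) ->
  jointly_equidistributed q1 q2.
Proof.
move=> swap n _ k l; have [f f_inj fE] := swap n.
rewrite -[RHS](card_preimset _ f_inj); congr #|pred_of_set _|.
by apply/setP => p; rewrite !inE; have [-> ->] := fE p; rewrite andbC.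
Qed.

Lemma equidistributed_by_reversal s outer key :
  all (fun ab => (ab.1 < 4) && (ab.2 < 4)) s ->
  mesh_splits s outer key -> key_separates key ->
  (forall n i k lo hi x y, i < n -> k < n -> x < n ->
     outer (n - k.+1) (n - i.+1) lo hi (n - x.+1) y = outer i k lo hi x y) ->
  jointly_equidistributed (MeshPattern perm123 (boxes s))
                          (MeshPattern perm321 (boxes s)).
Proof.
move=> s4 hs hkey outerC; apply: jointly_equidistributed_swap => n.
exists (fun q => (reversal n * q)%g) => [|p]; first exact: mulgI.
have E d q := @occurrences_outer_pairs n q d s outer key s4 hs hkey.
by split; rewrite (E true) (E false) outer_pairs_reversal // => *; apply: outerC.
Qed.

Lemma equidistributed_by_complement s outer key :
  all (fun ab => (ab.1 < 4) && (ab.2 < 4)) s ->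
  mesh_splits s outer key -> key_separates key ->
  (forall n i k lo hi x y, lo < n -> hi < n -> y < n ->
     outer i k (n - hi.+1) (n - lo.+1) x (n - y.+1) = outer i k lo hi x y) ->
  jointly_equidistributed (MeshPattern perm123 (boxes s))
                          (MeshPattern perm321 (boxes s)).
Proof.
move=> s4 hs hkey outerC; apply: jointly_equidistributed_swap => n.
exists (fun q => (q * reversal n)%g) => [|p]; first exact: mulIg.
have E d q := @occurrences_outer_pairs n q d s outer key s4 hs hkey.
by split; rewrite (E true) (E false) outer_pairs_complement // => *; apply: outerC.
Qed.

(** * Checking the eight shadings *)

Ltac compare_with u v :=
  case: (ltngtP u v) => ?; try (exfalso; lia).

(* Deciding all comparisons first is much faster than one call to [lia]. *)
Ltac decide_splits :=
  let d := fresh in let n := fresh in let i := fresh in let j := fresh in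
  let k := fresh in let lo := fresh in let mid := fresh in
  let hi := fresh in let x := fresh in let y := fresh in
  intros d n i j k lo mid hi x y ? ? ? ? ? ?; destruct d;
  rewrite /avoids_boxes /inside /= !ltnS; compare_with x n; compare_with y n;
  compare_with x i; compare_with x j; compare_with x k;
  compare_with y lo; compare_with y mid; compare_with y hi => //= *; lia.

Theorem theorem3p3 (R : {set 'I_4 * 'I_4})
  (hR : R \in [:: A25; A26; A27; A28; A29; A30; A31; A32]) :
  jointly_equidistributed (MeshPattern perm123 R) (MeshPattern perm321 R).
Proof.
(* Each condition encodes six shaded boxes: two outer columns without their top or bottom box, or
   two outer rows without their left or right box. The bounds are weak because points on grid lines
   lie in no box. *)
pose below (i k lo hi x y : nat) := (y <= hi) ==> (i <= x <= k).
pose above (i k lo hi x y : nat) := (lo <= y) ==> (i <= x <= k).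
pose right (i k lo hi x y : nat) := (i <= x) ==> (lo <= y <= hi).
pose left (i k lo hi x y : nat) := (x <= k) ==> (lo <= y <= hi).
pose leftmost (n x y : nat) := x.
(* Subtracting from [n] reverses the order of coordinates below [n], so a maximum becomes a minimal
   key. *)
pose rightmost (n x y : nat) := n - x.
pose lowest (n x y : nat) := y.
pose highest (n x y : nat) := n - y.
move: hR; rewrite !inE => /or4P[|||/or4P[|||/orP[|]]] /eqP->;
  [ apply: (@equidistributed_by_reversal _ below leftmost)
  | apply: (@equidistributed_by_complement _ right lowest)
  | apply: (@equidistributed_by_reversal _ above rightmost)
  | apply: (@equidistributed_by_reversal _ above leftmost)
  | apply: (@equidistributed_by_complement _ left highest)
  | apply: (@equidistributed_by_complement _ left lowest)
  | apply: (@equidistributed_by_complement _ right highest)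
  | apply: (@equidistributed_by_reversal _ below rightmost) ];
  rewrite /below /above /right /left /leftmost /rightmost /lowest /highest //;
  lazymatch goal with
  | |- mesh_splits _ _ _ => decide_splits
  | _ => by move=> *; lia
  end.
Qed.
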